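(* For every integer $k\ge 0$, the $k$th classical numerator $P_k$ and the $k$th classical denominator $Q_k$ of the continued fraction $$b_0+\cfrac{-1+a_1}{1+b_1+\cfrac{-1+a_2}{1+b_2+\cfrac{-1+a_3}{1+b_3+\cdots}}}$$ in noncommuting indeterminates $a_1,a_2,\dots,b_0,b_1,\dots$ are given by $$P_k=-\sigma(k)+\sum_{m \in \mathcal{R}_{k-1}} (-1)^{g_{k-1}(m)}\, m+\sum_{m \in \mathcal{R}_k} (-1)^{g_k(m)}\, m,$$ and $$Q_k=\sigma(k+1)-\sum_{\substack{m \in \mathcal{R}_k \\ \lambda_\ell>1}} (-1)^{g_{k}(m)} \phi(m)-\sum_{\substack{m \in \mathcal{R}_{k+1} \\ \lambda_\ell>1}} (-1)^{g_{k+1}(m)} \phi(m),$$ where in the sums for $Q_k$, $\lambda_\ell$ denotes the last (smallest) component of the index of $m$.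
   Context: Let $\mathcal{M}$ be the free monoid on the noncommuting indeterminates $a_1,a_2,\dots,b_0,b_1,b_2,\dots$ and $\mathbb{Z}[\mathcal{M}]$ its monoid ring (noncommutative polynomials with integer coefficients). The classical numerators and denominators of the continued fraction are the elements of $\mathbb{Z}[\mathcal{M}]$ defined by $P_0=b_0$, $P_1=-1+b_0+b_1b_0+a_1$, $Q_0=1$, $Q_1=1+b_1$, and, for $k\ge 2$, $X_k=(-1+a_k)X_{k-2}+(1+b_k)X_{k-1}$ for both $X=P$ and $X=Q$. A monomial $m=y_1y_2\cdots y_\ell$ ($\ell\ge 1$, each $y_j$ an indeterminate) has index $[\lambda_1,\dots,\lambda_\ell]$, where $\lambda_j$ is the subscript of $y_j$ (so $y_j=a_{\lambda_j}$ or $y_j=b_{\lambda_j}$). For an integer $k\ge -1$, $\mathcal{R}_k$ is the set of monomials $m=y_1\cdots y_\ell$ with $\ell\ge1$ satisfying: (R1) $k\ge\lambda_1>\lambda_2>\dots>\lambda_\ell\ge 0$; (R2) $\lambda_1\equiv k\pmod 3$; (R3) for $1\le j<\ell$, if $y_j=a_{\lambda_j}$ then $\lambda_j\not\equiv\lambda_{j+1}+1\pmod 3$; (R4) for $1\le j<\ell$, if $y_j=b_{\lambda_j}$ then $\lambda_j\not\equiv\lambda_{j+1}\pmod 3$; (R5) if $y_\ell=a_{\lambda_\ell}$ then $\lambda_\ell\not\equiv 2\pmod 3$; (R6) if $y_\ell=b_{\lambda_\ell}$ then $\lambda_\ell\not\equiv 1\pmod 3$. (In particular $\mathcal{R}_{-1}=\emptyset$.)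 For $m\in\mathcal{R}_k$ with index $[\lambda_1,\dots,\lambda_\ell]$, $g_k(m)$ is the maximum number of pairwise disjoint sets of three consecutive integers whose union is a subset of $\{-1,0,1,\dots,k\}\setminus\{\lambda_1,\dots,\lambda_\ell\}$. $\sigma(k)=\frac{2\sqrt3}{3}\sin\left(\frac{k\pi}{3}\right)$, the 6-periodic sequence $0,1,1,0,-1,-1,\dots$ for $k=0,1,2,\dots$. $\phi:\mathbb{Z}[\mathcal{M}]\to\mathbb{Z}[\mathcal{M}]$ is the substitution ring homomorphism with $\phi(a_1)=\phi(b_0)=\phi(b_1)=0$, and $\phi(a_j)=a_{j-1}$, $\phi(b_j)=b_{j-1}$ for $j>1$. *)

(* Defs.v *)
From HB Require Import structures.
From mathcomp Require Import all_boot all_order all_algebra finmap.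
From mathcomp.multinomials Require Import monalg.
From mathcomp Require reals trigo.
From mathcomp Require Import zify ring lra.

Set Implicit Arguments.
Unset Strict Implicit.
Unset Printing Implicit Defensive.

Import Order.TTheory GRing.Theory Num.Theory.

Local Open Scope ring_scope.

(* IndetA i stands for a_(i+1), since there is no indeterminate a_0, whereas
   IndetB i stands for b_i. *)
Inductive indet := IndetA of nat | IndetB of nat.

Definition sum_of_indet (y : indet) : nat + nat :=
  match y with IndetA i => inl i | IndetB i => inr i end.
Definition indet_of_sum (u : nat + nat) : indet :=
  match u with inl i => IndetA i | inr i => IndetB i end.
Lemma sum_of_indetK : cancel sum_of_indet indet_of_sum.
Proof. by case. Qed.

HB.instance Definition _ := Countable.copy indet (can_type sum_of_indetK).

Definition is_a (y : indet) : bool := if y is IndetA _ then true else false.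

Definition subscript (y : indet) : nat :=
  match y with IndetA i => i.+1 | IndetB i => i end.

Notation mon := {fmonom indet}.
Notation ZM := {malg int[{fmonom indet}]}.

Definition indet_poly (y : indet) : ZM := << FMonom [:: y] >>.

(* a_ 0 is a junk value, which is never used. *)
Definition a_ (j : nat) : ZM := indet_poly (IndetA j.-1).
Definition b_ (j : nat) : ZM := indet_poly (IndetB j).

(* Recurrence for the classical numerators and denominators of the continued
   fraction with partial numerators -1 + a_k and partial denominators 1 + b_k
   (k >= 1); coefficients multiply on the left. *)
Fixpoint cf_rec (X0 X1 : ZM) (k : nat) {struct k} : ZM :=
  match k with
  | 0 => X0
  | k'.+1 =>
    match k' with
    | 0 => X1
    | k''.+1 => (-1 + a_ k) * cf_rec X0 X1 k'' + (1 + b_ k) * cf_rec X0 X1 k'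
    end
  end.

Definition P_ : nat -> ZM := cf_rec (b_ 0) (-1 + b_ 0 + b_ 1 * b_ 0 + a_ 1).
Definition Q_ : nat -> ZM := cf_rec 1 (1 + b_ 1).

Lemma P_SS k : P_ k.+2 = (-1 + a_ k.+2) * P_ k + (1 + b_ k.+2) * P_ k.+1.
Proof. by []. Qed.

Lemma Q_SS k : Q_ k.+2 = (-1 + a_ k.+2) * Q_ k + (1 + b_ k.+2) * Q_ k.+1.
Proof. by []. Qed.

Definition mindex (m : mon) : seq nat := [seq subscript y | y <- m : seq indet].

Definition last_mindex (m : mon) : nat := last 0%N (mindex m).

Definition adjacent_ok (y z : indet) : bool :=
  if is_a y then subscript y != (subscript z).+1 %[mod 3]
  else subscript y != subscript z %[mod 3].

Definition last_ok (y : indet) : bool :=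
  if is_a y then subscript y != 2 %[mod 3] else subscript y != 1 %[mod 3].

Definition in_R (k : int) (m : mon) : bool :=
  if m : seq indet is y :: m' then
    [&& (subscript y)%:Z <= k,
        sorted gtn (mindex m),
        ((subscript y)%:Z == k %[mod 3])%Z,
        sorted adjacent_ok m
      & last_ok (last y m')]
  else false.

Definition indets_at (n : nat) : seq indet :=
  IndetB n :: (if n is i.+1 then [:: IndetA i] else [::]).

(* All words with strictly decreasing subscripts smaller than n. *)
Fixpoint dec_words (n : nat) : seq (seq indet) :=
  if n is n'.+1 then
    dec_words n' ++ [seq y :: w | y <- indets_at n', w <- dec_words n']
  else [:: [::]].

(* The bounded set of words is only there to make the comprehension finite:
   see mem_calR. *)
Definition calR (k : int) : {fset mon} :=
  [fset m in [seq FMonom w : mon | w <- dec_words (`|k|%N).+1] | in_R k m]%fset.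

Lemma dec_wordsS n :
  dec_words n.+1 =
  dec_words n ++ [seq y :: w | y <- indets_at n, w <- dec_words n].
Proof. by []. Qed.

Lemma gtn_trans : transitive gtn.
Proof. by move=> y x z /= lt_yx lt_zy; exact: ltn_trans lt_yx. Qed.

Lemma mem_dec_words n (w : seq indet) :
  sorted gtn [seq subscript y | y <- w] ->
  (forall y, y \in w -> (subscript y < n)%N) -> w \in dec_words n.
Proof.
elim: n w => [|n IHn] [|y w] // sw lt_w.
- by have := lt_w y (mem_head _ _).
- by rewrite /= mem_cat IHn.
have lt_wy z : z \in w -> (subscript z < subscript y)%N.
  move: sw; rewrite /= path_sortedE; last exact: gtn_trans.
  by case/andP=> /allP h _ zw; apply/h/map_f.
have ltyn := lt_w y (mem_head _ _).
rewrite dec_wordsS mem_cat; have [yn|yn] := ltnP (subscript y) n.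
  by rewrite IHn // => z; rewrite inE => /orP[/eqP->//|/lt_wy/ltn_trans->].
have {ltyn}yn : subscript y = n by apply/eqP; rewrite eqn_leq yn -ltnS ltyn.
apply/orP; right; apply: (@allpairs_f _ _ _ cons); last first.
  by apply: IHn; [exact: path_sorted sw | move=> z /lt_wy; rewrite yn].
by rewrite -yn {sw lt_w lt_wy yn}; case: y => i; rewrite !inE /= eqxx ?orbT.
Qed.

Lemma mem_calR k m : (m \in calR k) = in_R k m.
Proof.
rewrite !inE; apply/andP/idP=> [[_ Rm]|Rm]; [exact: Rm | split; last exact: Rm].
apply/mapP; exists (m : seq indet); last by case: (m).
case: m Rm => -[//|y w] Rm; apply: (@mem_dec_words _ (y :: w)) => [|z].
  by case/and5P: Rm.
case/and5P: Rm => lek /= sw _ _ _ zw.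
have ley : (subscript y <= `|k|)%N by case: (k) lek.
rewrite ltnS (leq_trans _ ley) //; move: zw; rewrite inE => /orP[/eqP->//|zw].
move: sw; rewrite /= path_sortedE; last exact: gtn_trans.
by case/andP=> /allP h _; apply/ltnW/h/map_f.
Qed.

(* For k >= -1: {-1, 0, ..., k} minus the components of the index of m. *)
Definition avail (k : int) (m : mon) : {fset int} :=
  [fset x in [seq i%:Z - 1 | i <- iota 0 `|(k + 2)%R|%N]
        | x \notin [seq i%:Z | i <- mindex m]]%fset.

Lemma mem_avail k m x : -1 <= k ->
  (x \in avail k m) = (-1 <= x <= k) && (x \notin [seq i%:Z | i <- mindex m]).
Proof.
move=> k_ge; rewrite !inE /=; congr (_ && _).
apply/mapP/andP=> [[i]|[x_ge x_le]].
  rewrite mem_iota add0n => /andP[_ ilt] ->; split; first by lia.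
  by lia.
exists `|(x + 1)%R|%N; last by lia.
by rewrite mem_iota add0n; lia.
Qed.

Definition triple (A : {fset int}) : bool :=
  [exists i : A,
    A == [fset val i; (val i + 1)%R; (val i + 2)%R]%fset].

(* T ranges over the families of subsets of avail k m; trivIfset T says that
   the members of T are pairwise disjoint. *)
Definition g_ (k : int) (m : mon) : nat :=
  (\max_(T <- fpowerset (fpowerset (avail k m)) | all triple T && trivIfset T)
    #|` T|)%N.

(* sigma takes integer values, and is thus given by its period; sigmaE below
   is the trigonometric formula. *)
Definition sigma (k : nat) : int := [:: 0; 1; 1; 0; -1; -1]`_(k %% 6).

Module SigmaFormula.
Import reals trigo.

Lemma sigmaE (R : realType) (k : nat) :
  (sigma k)%:~R = 2 * Num.sqrt 3 / 3 * sin (k%:R * pi / 3) :> R.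
Proof.
have pi0 := pi_gt0 R.
set s : R := sin (pi / 3); set c : R := cos (pi / 3).
have s_gt0 : 0 < s by apply: sin_gt0_pi; apply/andP; split; lra.
have cs : c ^+ 2 + s ^+ 2 = 1 by rewrite /c /s cos2Dsin2.
have c2 : cos (pi / 3 + pi / 3) = c * c - s * s :> R by rewrite cosD.
have s2 : sin (pi / 3 + pi / 3) = s * c + c * s :> R by rewrite sinD.
have s3 : (s * c + c * s) * c + (c * c - s * s) * s = 0.
  rewrite -s2 -c2 -sinD -[RHS]sinpi; congr sin; lra.
have c3 : (c * c - s * s) * c - (s * c + c * s) * s = - 1.
  rewrite -s2 -c2 -cosD -[RHS]cospi; congr cos; lra.
have s_neq0 : s != 0 by rewrite gt_eqF.
have c24 : c * c * 4 = 1.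
  have : s * (c * c * 4 - 1) = 0 by rewrite -s3; nra.
  by move/eqP; rewrite mulf_eq0 (negbTE s_neq0) subr_eq0 => /eqP.
have ch : c = 1 / 2 by nra.
have q3 : Num.sqrt 3 = 2 * s :> R.
  have -> : 3 = (2 * s) ^+ 2 :> R by nra.
  by rewrite sqrtr_sqr gtr0_norm //; lra.
have ss : s * s = 3 / 4 by nra.
have sin2 : sin (2 * pi / 3) = s :> R.
  by rewrite (_ : 2 * pi / 3 = pi / 3 + pi / 3); [rewrite s2 ch; lra | lra].
have sinDpi' (x : R) : sin (x + pi) = - sin x by rewrite sinDpi.
have step6 j : sin ((j + 6)%N%:R * pi / 3) = sin (j%:R * pi / 3) :> R.
  rewrite natrD (_ : (j%:R + 6%:R) * pi / 3 = j%:R * pi / 3 + pi + pi); last lra.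
  by rewrite !sinDpi' opprK.
have -> : sin (k%:R * pi / 3) = sin ((k %% 6)%N%:R * pi / 3) :> R.
  rewrite {1}(divn_eq k 6); elim: (k %/ 6)%N => [|q <-]; first by rewrite mul0n.
  by rewrite -(step6 (q * 6 + k %% 6)%N) mulSn -addnA addnC.
rewrite /sigma q3; move: (ltn_pmod k (isT : 0 < 6)%N).
case: (k %% 6)%N => [|[|[|[|[|[|//]]]]]] _ /=.
- by rewrite !mul0r sin0 mulr0.
- by rewrite mul1r -/s; nra.
- by rewrite sin2; nra.
- by rewrite (_ : 3%:R * pi / 3 = pi); [rewrite sinpi mulr0 | lra].
- by rewrite (_ : 4%:R * pi / 3 = pi / 3 + pi) ?sinDpi' -/s; [nra | lra].
- by rewrite (_ : 5%:R * pi / 3 = 2 * pi / 3 + pi) ?sinDpi' ?sin2; [nra | lra].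
Qed.
End SigmaFormula.

Definition phi_indet (y : indet) : ZM :=
  match y with
  | IndetA i.+1 => a_ i.+1
  | IndetB i.+2 => b_ i.+1
  | _ => 0
  end.

Definition phi_mon (m : mon) : ZM := \prod_(y <- m : seq indet) phi_indet y.

Definition phi : ZM -> ZM := mmap (intr : int -> ZM) phi_mon.

Fact phi_mon_mmorphism : mmorphism phi_mon.
Proof.
split=> [m1 m2|]; rewrite /phi_mon.
  by rewrite [mmul m1 m2]fmmulE big_cat.
by rewrite [mone]fmoneE big_nil.
Qed.

HB.instance Definition _ := isMultiplicative.Build mon ZM phi_mon
  phi_mon_mmorphism.

HB.instance Definition _ := GRing.Additive.on phi.

Fact phi_multiplicative : multiplicative phi.
Proof.
by apply: commr_mmap_is_multiplicative => g m m'; exact/commr_sym/commr_int.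
Qed.

HB.instance Definition _ := GRing.isMultiplicative.Build ZM ZM phi
  phi_multiplicative.

Lemma phi_indet_poly y : phi (indet_poly y) = phi_indet y.
Proof. by rewrite /phi mmapU mul1r /phi_mon big_seq1. Qed.

(* Main.v *)
Require Import Defs.
From HB Require Import structures.
From mathcomp Require Import all_boot all_order all_algebra finmap.
From mathcomp.multinomials Require Import monalg.
From mathcomp Require Import zify.

(** Write S_k for the signed sum over R_k, and S_k = 0 for k < 0.  The whole
    theorem rests on one recurrence for S_k, obtained by looking at the first
    letter of a word of R_k.

    If the first subscript is smaller than k, it is at most k - 3, and the word
    belongs to R_(k-3); passing from k - 3 to k frees three more consecutive
    integers above the word, hence changes the sign (g_in_R).  If the first
    letter y has subscript k, then either y is the whole word, or the rest of
    the word has its first subscript in two of the three residue classes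
    modulo 3, which means that it lies in R_(k-1) or R_(k-2) when y = b_k, and in
    R_(k-2) or R_(k-3) when y = a_k (mem_tails, perm_calR).  Adding y
    in front of the rest does not change its sign, because the at most two
    integers set free below y do not make room for one more triple
    (g_word_cons).  Finally the sign of the word y itself is a value of sigma,
    and y is forbidden as a last letter exactly when this value is 0
    (sigma_last_ok).  Altogether
    (signed_sum_rec), for k >= 2,
      S_k + S_(k-3) = a_k (- sigma (k-2) + S_(k-2) + S_(k-3))
                      + b_k (- sigma (k-1) + S_(k-1) + S_(k-2)),
    which together with sigma (k+2) = sigma (k+1) - sigma k says that
    N_k = - sigma k + S_(k-1) + S_k satisfies the recurrence of the continued
    fraction (cf_numer_rec).  Since N_0 = P_0 and N_1 = P_1, this gives P_k.

    The argument only touches the first letter, so the same recurrence holds,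
    for k >= c, for the sums restricted to the words whose last subscript is at
    least c.  For c = 2 the sequence N starts with N_0 = 0 and N_1 = -1, and - phi
    turns the recurrence of N_(k+1) into that of Q_k, because phi lowers the
    subscripts by one; hence Q_k = - phi N_(k+1).

    The exponents g are reduced to lengths of runs of free integers: in a set of
    integers, adding three consecutive integers above all the others adds
    exactly one to the maximal number of disjoint triples
    (packing_numberU_triple), while adding one or two integers just above a hole
    adds nothing. *)

Set Implicit Arguments.
Unset Strict Implicit.
Unset Printing Implicit Defensive.

Import Order.TTheory GRing.Theory.

Local Open Scope ring_scope.

(** * Packings of a set of integers by triples of consecutive integers *)

Definition packing_number (A : {fset int}) : nat :=
  (\max_(T <- fpowerset (fpowerset A) | all triple T && trivIfset T) #|` T|)%N.

Definition is_packing (A : {fset int}) (T : {fset {fset int}}) : Prop :=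
  [/\ {in T, forall B, (B `<=` A)%fset}, {in T, forall B, triple B}
    & {in T &, forall B C, B != C -> [disjoint B & C]%fset}].

Lemma packingP A T :
  reflect (is_packing A T)
    [&& T \in fpowerset (fpowerset A), all triple T & trivIfset T].
Proof.
rewrite fpowersetE; apply: (iffP and3P) => [[/fsubsetP sTA tT /trivIfsetP]|].
  split=> // B BT; last exact: (allP tT).
  by rewrite -fpowersetE sTA.
case=> sTA tT dT; split; first by apply/fsubsetP => B /sTA; rewrite fpowersetE.
  by apply/allP => B /tT.
exact/trivIfsetP.
Qed.

Lemma leq_packing_number A T :
  is_packing A T -> (#|` T| <= packing_number A)%N.
Proof.
case/packingP/and3P => TA tT dT.
by apply: (leq_bigmax_seq T) => //; rewrite tT.
Qed.

Lemma packing_number_witness A :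
  exists2 T, is_packing A T & #|` T| = packing_number A.
Proof.
rewrite /packing_number big_seq_cond.
elim/big_ind: _ => [|m n [T pT cT] [U pU cU]|T TP].
- by exists fset0; [split=> B; rewrite ?in_fset0 | rewrite cardfs0].
- by case: (leqP m n) => _; [exists U | exists T].
- by exists T => //; apply/packingP; case/and3P: TP => -> -> ->.
Qed.

Lemma tripleP (A : {fset int}) :
  reflect (exists i : int, A = [fset i; (i + 1)%R; (i + 2)%R]%fset) (triple A).
Proof.
apply: (iffP existsP) => [[i /eqP iA]|[i iA]]; first by exists (val i).
have iiA : i \in A by rewrite iA !inE eqxx.
by exists (FSetSub iiA); rewrite /= -iA.
Qed.

Lemma eq_packing_number (A B : {fset int}) :
  (A `<=` B)%fset ->
  (forall C, triple C -> (C `<=` B)%fset -> (C `<=` A)%fset) ->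
  packing_number B = packing_number A.
Proof.
move=> sAB tBA; apply/eqP; rewrite eqn_leq; apply/andP; split.
  have [T [sT tT dT] <-] := packing_number_witness B.
  apply: leq_packing_number; split=> // C CT.
  by apply: tBA; [exact: tT | exact: sT].
have [T [sT tT dT] <-] := packing_number_witness A.
apply: leq_packing_number; split=> // C CT.
exact: fsubset_trans (sT _ CT) sAB.
Qed.

(** A triple that meets the three new integers has no element above x + 2, hence
    contains x; so a packing has at most one such triple, and removing it leaves
    a packing of A. *)
Lemma packing_numberU_triple (A : {fset int}) (x : int) :
  (forall z, z \in A -> z < x) ->
  packing_number (A `|` [fset x; (x + 1)%R; (x + 2)%R])%fset
  = (packing_number A).+1.
Proof.
move=> Alt; set I := [fset x; (x + 1)%R; (x + 2)%R]%fset.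
have inI z : (z \in I) = (x <= z <= x + 2) by rewrite !inE; lia.
have dAI : [disjoint A & I]%fset.
  by apply/fdisjointP => z /Alt zx; rewrite inI; lia.
apply/eqP; rewrite eqn_leq; apply/andP; split.
  have [T [sT tT dT] <-] := packing_number_witness (A `|` I)%fset.
  have x_in B z : B \in T -> z \in B -> x <= z -> x \in B.
    move=> BT zB xz; have /tripleP[i iB] := tT B BT.
    have /(fsubsetP (sT _ BT)) : i + 2 \in B by rewrite iB !inE eqxx !orbT.
    have := zB; rewrite iB !inE => ? /orP[/Alt|]; lia.
  have sTA (B : {fset int}) : B \in T -> x \notin B -> (B `<=` A)%fset.
    move=> BT xB; apply/fsubsetP => z zB.
    have := fsubsetP (sT _ BT) z zB; rewrite in_fsetU inI => /orP[//|zI].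
    by case/negP: xB; apply: (x_in B z) => //; lia.
  case: (@hasP _ (fun B : {fset int} => x \in B) T) => [[B BT xB]|noB].
    rewrite (cardfsD1 B) BT ltnS; apply: leq_packing_number; split.
    - move=> C; rewrite in_fsetD1 => /andP[CB CT]; apply: (sTA C CT).
      have := dT _ _ CT BT CB; rewrite fdisjoint_sym => /fdisjointP; exact.
    - by move=> C; rewrite in_fsetD1 => /andP[_ /tT].
    - by move=> C D; rewrite !in_fsetD1 => /andP[_ CT] /andP[_ DT]; apply: dT.
  apply/leqW/leq_packing_number; split=> // B BT; apply: sTA => //.
  by apply/negP => xB; apply: noB; exists B.
have [T [sT tT dT] <-] := packing_number_witness A.
have dI B : B \in T -> [disjoint B & I]%fset.
  by move=> /sT sB; apply: fdisjointWl sB dAI.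
have IT : I \notin T.
  by apply/negP => /sT /fsubsetP /(_ x); rewrite inI => /(_ _)/Alt; lia.
have -> : #|` T|.+1 = #|` (I |` T)%fset| by rewrite cardfsU1 IT.
apply: leq_packing_number; split.
- move=> B; rewrite in_fset1U => /orP[/eqP->|/sT]; first exact: fsubsetUr.
  by move/fsubset_trans; apply; exact: fsubsetUl.
- move=> B; rewrite in_fset1U => /orP[/eqP->|/tT//].
  by apply/tripleP; exists x.
- move=> B C; rewrite !in_fset1U => /orP[/eqP->|BT] /orP[/eqP->|CT].
  + by rewrite eqxx.
  + by rewrite fdisjoint_sym dI.
  + by rewrite dI.
  + exact: dT.
Qed.

(** * The exponents g *)

Lemma g_E k m : g_ k m = packing_number (avail k m).
Proof. by []. Qed.

(** Allowing k = -2, for which no integer is available, makes the empty word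
    behave as a word whose first letter has subscript -2: see g_nil. *)
Lemma in_avail k m x : -2 <= k ->
  (x \in avail k m) = (-1 <= x <= k) && (x \notin [seq i%:Z | i <- mindex m]).
Proof.
move=> k_ge; have [k1|k1] := leP (-1) k; first exact: mem_avail.
have -> : k = - 2 by lia.
by rewrite !inE /=; case: (x \notin _); lia.
Qed.

Lemma g_add3 k m : -2 <= k -> {in mindex m, forall i, i%:Z <= k} ->
  g_ (k + 3) m = (g_ k m).+1.
Proof.
move=> k_ge m_le; rewrite !g_E -(@packing_numberU_triple _ (k + 1)); last first.
  by move=> z; rewrite in_avail //; lia.
congr packing_number; apply/fsetP => z.
rewrite in_fsetU !in_avail; try lia.
have [/mapP[i /m_le ik ->]|zm] := boolP (z \in [seq i%:Z | i <- mindex m]);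
  rewrite !inE /=; lia.
Qed.

(** A triple using one of the r <= 2 new integers would have to contain the
    hole k. *)
Lemma g_add_short k m r : (r < 3)%N -> -2 <= k ->
  {in mindex m, forall i, i%:Z <= k} -> k \notin avail k m ->
  g_ (k + r%:Z) m = g_ k m.
Proof.
move=> r3 k_ge m_le kA; rewrite !g_E; apply: eq_packing_number.
  by apply/fsubsetP => z; rewrite !in_avail; lia.
move=> C /tripleP[i iC] /fsubsetP sC.
have {}sC z : i <= z <= i + 2 -> z \in avail (k + r%:Z) m.
  by move=> iz; apply: sC; rewrite iC !inE; lia.
have [ik|ik] := leP (i + 2) k.
  apply/fsubsetP => z; rewrite iC => zC; have /sC : i <= z <= i + 2.
    by move: zC; rewrite !inE; lia.
  by rewrite !in_avail; try lia; move: zC; rewrite !inE; lia.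
have := sC (i + 2); rewrite in_avail; last lia.
have := sC k; move: kA; rewrite !in_avail; try lia.
Qed.

(** The integers k + 1, ..., k + n form a run that the hole k separates from the
    other available integers. *)
Lemma g_gap k m n : -2 <= k -> {in mindex m, forall i, i%:Z <= k} ->
  k \notin avail k m -> g_ (k + n%:Z) m = (n %/ 3 + g_ k m)%N.
Proof.
move=> k_ge m_le kA; rewrite {1}(divn_eq n 3) addnC.
elim: (n %/ 3)%N => [|q IHq]; first by rewrite addn0 g_add_short ?ltn_pmod.
rewrite (_ : k + _ = k + (n %% 3 + q * 3)%N%:Z + 3); last lia.
rewrite g_add3 ?IHq //; first lia.
by move=> i /m_le; lia.
Qed.

Lemma g_nil n : g_ (n%:Z - 2) (FMonom [::]) = (n %/ 3)%N.
Proof.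
rewrite addrC g_gap // ?in_avail //.
have [T [sT tT _] cT] := packing_number_witness (avail (- 2) (FMonom [::])).
rewrite g_E -cT; apply/eqP; rewrite -[X in _ == X]addn0 eqn_add2l cardfs_eq0.
apply/eqP/fsetP => B; rewrite in_fset0; apply/negP => BT.
have /tripleP[i iB] := tT B BT; have /fsubsetP/(_ i) := sT B BT.
by rewrite in_avail // iB !inE eqxx; lia.
Qed.

Lemma g_cons y w : {in w, forall z, subscript z < subscript y}%N ->
  g_ (subscript y)%:Z (FMonom (y :: w)) = g_ ((subscript y)%:Z - 1) (FMonom w).
Proof.
move=> lt_wy; rewrite !g_E; congr packing_number; apply/fsetP => x.
rewrite !in_avail //; try lia.
rewrite /mindex /= inE; set b := (x \in _); lia.
Qed.

Lemma g_letter y :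
  g_ (subscript y)%:Z (FMonom [:: y]) = ((subscript y).+1 %/ 3)%N.
Proof. by rewrite g_cons // -g_nil; congr g_; lia. Qed.

Lemma in_R_ge0 k m : in_R k m -> 0 <= k.
Proof. by case: m => -[//|y w] /and5P[]; lia. Qed.

Lemma in_R_bounded k m : in_R k m -> {in mindex m, forall i, i%:Z <= k}.
Proof.
case: m => -[//|y w] /and5P[yk /= sw _ _ _] i; rewrite inE => /orP[/eqP->//|iw].
move: sw; rewrite path_sortedE; last exact: gtn_trans.
case/andP=> /allP/(_ i iw) /=; lia.
Qed.

(** The run of free integers above a word of R_k has length divisible by 3, so
    that n more integers make room for n %/ 3 more triples. *)
Lemma g_in_R k m n : in_R k m -> g_ (k + n%:Z) m = (n %/ 3 + g_ k m)%N.
Proof.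
move=> Rm; have k_ge := in_R_ge0 Rm; case: m Rm => -[//|y w] Rm.
have Ry : in_R (subscript y)%:Z (FMonom (y :: w)).
  by case/and5P: Rm => _ sw _ aw lw; apply/and5P; split.
have yA : (subscript y)%:Z \notin avail (subscript y)%:Z (FMonom (y :: w)).
  by rewrite in_avail // /mindex /= inE eqxx andbF.
have [yk ky] : (subscript y)%:Z <= k /\ ((subscript y)%:Z == k %[mod 3])%Z.
  by case/and5P: Rm.
have [q kE] : exists q, k = (subscript y)%:Z + (q * 3)%N%:Z.
  by exists (`|k - (subscript y)%:Z| %/ 3)%N; lia.
have -> : k + n%:Z = (subscript y)%:Z + (q * 3 + n)%N%:Z by lia.
rewrite kE !g_gap //; try exact: in_R_bounded.
by rewrite divnMDl // mulnK // -addnA addnCA.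
Qed.

(** * Decomposition of R_k according to the first letter *)

Definition word_cons (y : indet) (m : mon) : mon := FMonom (y :: m).

Lemma word_cons_inj y y' m m' :
  word_cons y m = word_cons y' m' -> y = y' /\ m = m'.
Proof. by case: m m' => [w] [w'] [-> ->]. Qed.

Lemma mem_indets_at y k : (y \in indets_at k) = (subscript y == k).
Proof.
case: y k => i [|k]; rewrite !inE //=.
by rewrite orbF; apply/eqP/eqP => [[->]|->].
Qed.

(** The words that may follow y in a word of R_k, where y has subscript k.  The
    words of the two sets R_j have first subscript congruent to j modulo 3: these
    are the two residues that the adjacency condition allows after y. *)
Definition tails (k : nat) (y : indet) : seq mon :=
  nseq (last_ok y) (FMonom [::])
    ++ calR (k%:Z - 1 - (is_a y : nat)%:Z)
    ++ calR (k%:Z - 2 - (is_a y : nat)%:Z).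

Lemma in_R_nil k : in_R k (FMonom [::]) = false. Proof. by []. Qed.

Lemma mem_tails (k : nat) y m : subscript y = k ->
  (m \in tails k y) = in_R k (word_cons y m).
Proof.
move=> yk; rewrite /tails !mem_cat !mem_calR mem_nseq.
case: m => -[|z w].
  by rewrite !in_R_nil !orbF /in_R /= yk lexx !eqxx /=; case: (last_ok y).
rewrite andbF /in_R /mindex /=.
case: (path gtn (subscript z) _); rewrite ?andbF //=.
case: (path adjacent_ok z w); rewrite ?andbF //=.
case: (last_ok (last z w)); rewrite ?andbF //= /adjacent_ok.
by case: y yk => i /= <-; lia.
Qed.

(** The first list collects the words with first subscript at most k - 3, which
    satisfy the same congruence condition as those of R_k. *)
Lemma perm_calR (k : nat) :
  perm_eq (calR k%:Z)
    (calR (k%:Z - 3) ++ [seq word_cons y m | y <- indets_at k, m <- tails k y]).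
Proof.
apply: uniq_perm; first exact: fset_uniq.
  rewrite cat_uniq fset_uniq andTb; apply/andP; split.
    apply/hasPn => _ /allpairsPdep[y [m [yk _ ->]]].
    rewrite mem_calR; apply/negP => /and5P[] /=.
    by move: yk; rewrite mem_indets_at => /eqP ->; lia.
  apply: allpairs_uniq_dep.
  - by case: k => [|k] //=.
  - move=> y yk; rewrite /tails !cat_uniq !fset_uniq !andbT !andTb.
    apply/and3P; split.
    + by case: (last_ok y).
    + apply/hasPn => m; rewrite mem_cat mem_nseq !mem_calR => mR.
      by apply: contraL mR => /andP[_ /eqP ->].
    + apply/hasPn => m; rewrite !mem_calR.
      case: m => -[|z w] // /and5P[_ _ k1 _ _]; apply/negP=> /and5P[_ _ k2 _ _].
      by move: k1 k2; lia.
  - move=> [y m] [y' m'] _ _ /= /word_cons_inj[-> ->] //.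
move=> m; rewrite mem_cat !mem_calR; apply/idP/orP.
  case: m => -[|y w] // Rm; have [yk|yk] := eqVneq (subscript y) k.
    right; apply/allpairsPdep; exists y, (FMonom w); split=> //.
      by rewrite mem_indets_at yk.
    by rewrite mem_tails.
  left; case/and5P: Rm => *; apply/and5P; split=> //; move: yk; lia.
case=> [|/allpairsPdep[y [w [yk wT ->]]]].
  case: m => -[|y w] // /and5P[*]; apply/and5P; split=> //; lia.
by rewrite -mem_tails //; apply/eqP; rewrite -mem_indets_at.
Qed.

(** * The recurrence for the signed sums over R_k *)

(** The cutoff c on the last subscript is 0 for the numerators, and 2 for the
    denominators; the latter keeps the words that phi does not send to 0. *)
Definition signed_sum (c : nat) (k : int) : ZM :=
  \sum_(m <- calR k | (c <= last_mindex m)%N) (-1) ^+ g_ k m * << m >>.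

Lemma signed_sum_lt c k : k < c%:Z -> signed_sum c k = 0.
Proof.
move=> kc; rewrite /signed_sum big_seq_cond big1 // => m /andP[].
rewrite mem_calR => Rm cm; have : last_mindex m \in mindex m.
  by case: m Rm {cm} => -[|y w] // _; rewrite /last_mindex /mindex /= mem_last.
by move/(in_R_bounded Rm); lia.
Qed.

Lemma malg_word_cons y m : << word_cons y m >> = indet_poly y * << m >> :> ZM.
Proof.
rewrite /indet_poly malgM_def fgmulUU mulr1.
by congr (<< _ >>); rewrite [mmul _ _]fmmulE.
Qed.

Lemma sigma_mod n : sigma n = sigma (n %% 6).
Proof. by rewrite /sigma modn_mod. Qed.

(** The sign of a word with the single letter y, with value 0 if the word is not
    allowed.  Both sides depend only on the subscript modulo 6. *)
Lemma sigma_last_ok y :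
  (if last_ok y then (-1) ^+ ((subscript y).+1 %/ 3) else 0 : int)
  = sigma ((subscript y).+2 - is_a y).
Proof.
have sign_mod n : (-1) ^+ (n %/ 3) = (-1) ^+ ((n %% 6) %/ 3) :> int.
  rewrite -signr_odd -[RHS]signr_odd; congr (_ ^+ (nat_of_bool _)); lia.
have last_ok_mod : last_ok y =
    if is_a y then (subscript y %% 6)%N \notin [:: 2; 5]
    else (subscript y %% 6)%N \notin [:: 1; 4].
  by rewrite /last_ok !inE; case: (is_a y); lia.
rewrite last_ok_mod sign_mod sigma_mod.
have -> : (((subscript y).+1 %% 6) = (((subscript y) %% 6).+1 %% 6))%N by lia.
have -> : (((subscript y).+2 - is_a y) %% 6
           = ((subscript y %% 6).+2 - is_a y) %% 6)%N.
  by case: (is_a y); lia.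
have := ltn_pmod (subscript y) (isT : 0 < 6)%N.
by move: (subscript y %% 6)%N => [|[|[|[|[|[|//]]]]]] _; case: (is_a y).
Qed.

(** The integers from k - r + 1 to k - 1, which y m leaves free and which do not
    count in the exponent on the right, are at most two; by g_in_R they do not
    make room for one more triple. *)
Lemma g_word_cons (k : nat) y m (r : nat) : subscript y = k -> (0 < r <= 3)%N ->
  in_R (k%:Z - r%:Z) m -> g_ k%:Z (word_cons y m) = g_ (k%:Z - r%:Z) m.
Proof.
move=> yk r13 Rm; rewrite -{1}yk g_cons => [|z zm].
  have -> : FMonom m = m by case: (m).
  have -> : (subscript y)%:Z - 1 = k%:Z - r%:Z + r.-1%:Z by lia.
  by rewrite (g_in_R r.-1 Rm) divn_small //; lia.
by have := in_R_bounded Rm (map_f subscript zm); lia.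
Qed.

Lemma last_word_cons k y m : in_R k m ->
  last_mindex (word_cons y m) = last_mindex m.
Proof. by case: m => -[]. Qed.

Lemma sign_mulCA (R : pzRingType) n (x y : R) :
  (-1) ^+ n * (x * y) = x * ((-1) ^+ n * y).
Proof. by rewrite mulrA -commr_sign -mulrA. Qed.

Lemma signed_sum_cons c (k : nat) y (r : nat) :
  subscript y = k -> (0 < r <= 3)%N ->
  \sum_(m <- calR (k%:Z - r%:Z) | (c <= last_mindex (word_cons y m))%N)
     (-1) ^+ g_ k%:Z (word_cons y m) * << word_cons y m >>
  = indet_poly y * signed_sum c (k%:Z - r%:Z).
Proof.
move=> yk r13; rewrite /signed_sum [RHS]mulr_sumr.
rewrite [LHS]big_seq_cond [RHS]big_seq_cond.
apply: eq_big => m.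
  by case: (boolP (m \in _)) => // /=; rewrite mem_calR => /last_word_cons->.
rewrite mem_calR => /andP[Rm _].
by rewrite (g_word_cons yk r13 Rm) malg_word_cons sign_mulCA.
Qed.

(** The term sigma (k + 2 - [y is an a]) accounts for the word y alone; it is
    - sigma (k - 1) for y = b_k and - sigma (k - 2) for y = a_k, but the shifted
    argument makes sense for all k. *)
Lemma signed_sum_rec c (k : nat) : (c <= k)%N ->
  signed_sum c k%:Z = - signed_sum c (k%:Z - 3)
   + \sum_(y <- indets_at k) indet_poly y *
       ((sigma (k.+2 - is_a y))%:~R
        + (signed_sum c (k%:Z - (is_a y).+1%:Z)
           + signed_sum c (k%:Z - (is_a y).+2%:Z))).
Proof.
move=> ck; rewrite {1}/signed_sum (perm_big _ (perm_calR k)) big_cat.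
congr (_ + _).
  rewrite /signed_sum -sumrN big_seq_cond [RHS]big_seq_cond.
  apply: eq_bigr => m /andP[]; rewrite mem_calR => /(g_in_R 3) /= gm _.
  by rewrite -{1}(subrK 3 k%:Z) gm exprS -!mulrA mulN1r.
rewrite big_mkcond big_allpairs_dep; apply: eq_big_seq => y.
rewrite mem_indets_at => /eqP yk.
rewrite -big_mkcond /= /tails !big_cat /= !mulrDr; congr (_ + _).
  rewrite -yk -sigma_last_ok yk big_nseq_cond {1}/last_mindex /= yk ck.
  case: (last_ok y) => /=; last by rewrite mulr0.
  rewrite [LHS]addr0 malg_word_cons -{1}yk g_letter yk.
  have -> : << FMonom [::] >> = 1 :> ZM by rewrite -fmoneE.
  rewrite sign_mulCA; congr (_ * _).
  by rewrite [RHS]rmorph_sign [LHS]mulr1.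
have -> : k%:Z - 1 - (is_a y : nat)%:Z = k%:Z - (is_a y).+1%:Z by lia.
have -> : k%:Z - 2 - (is_a y : nat)%:Z = k%:Z - (is_a y).+2%:Z by lia.
by rewrite !signed_sum_cons //; case: (is_a y).
Qed.

(** * Numerators and denominators *)

(** For c = 0 this is the formula for the numerators; for c = 2 it is, up to
    sign, the formula for the denominators of index k - 1 before phi is
    applied. *)
Definition cf_numer (c k : nat) : ZM :=
  (- sigma k)%:~R + signed_sum c (k%:Z - 1) + signed_sum c k%:Z.

Lemma sigma_rec k : sigma k.+2 = sigma k.+1 - sigma k.
Proof.
rewrite (sigma_mod k.+2) (sigma_mod k.+1) (sigma_mod k).
have -> : (k.+2 %% 6 = (k %% 6).+2 %% 6)%N by lia.
have -> : (k.+1 %% 6 = (k %% 6).+1 %% 6)%N by lia.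
have := ltn_pmod k (isT : 0 < 6)%N.
by move: (k %% 6)%N => [|[|[|[|[|[|//]]]]]] _.
Qed.

Lemma sigma_add3 k : sigma k.+3 = - sigma k.
Proof. by rewrite !sigma_rec addrAC subrr add0r. Qed.

Lemma sum_indets_atS k (F : indet -> ZM) :
  \sum_(y <- indets_at k.+1) F y = F (IndetB k.+1) + F (IndetA k).
Proof. by rewrite big_cons big_seq1. Qed.

(** The part of the proof of cf_numer_rec that holds in any ring: s0, s1 stand
    for sigma k, sigma (k + 1), and u0, u1, u2 for the signed sums over
    R_(k-1), R_k, R_(k+1). *)
Lemma cf_step (R : pzRingType) (a b s0 s1 u0 u1 u2 : R) :
  - (s1 - s0) + u2
    + (- u0 + (b * (- s1 + (u2 + u1)) + a * (- s0 + (u1 + u0))))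
  = (-1 + a) * (- s0 + u0 + u1) + (1 + b) * (- s1 + u1 + u2).
Proof.
have E : - (s1 - s0) + u2 - u0 = (- s1 + u1 + u2) - (- s0 + u0 + u1).
  rewrite [- s1 + u1 + u2]addrAC [- s0 + u0 + u1]addrC addrKA.
  by rewrite !opprD !opprK addrACA addrA.
rewrite !mulrDl mulN1r mul1r [RHS]addrACA (addrC (- (- s0 + u0 + u1))) -E.
rewrite -!addrA.
congr (_ + (_ + (_ + _))); rewrite addrC; congr (_ * (_ + _) + _ * (_ + _)).
all: by rewrite addrC.
Qed.

Lemma cf_numer_rec c k : (c <= k.+2)%N ->
  cf_numer c k.+2
  = (-1 + a_ k.+2) * cf_numer c k + (1 + b_ k.+2) * cf_numer c k.+1.
Proof.
move=> ck; rewrite /cf_numer (signed_sum_rec ck) sum_indets_atS.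
rewrite [is_a (IndetA _)]/= [is_a (IndetB _)]/= !subSS !subn0 !sigma_add3.
have -> : k.+2%:Z - 1 = k.+1 by lia.
have -> : k.+2%:Z - 2 = k by lia.
have -> : k.+2%:Z - 3 = k%:Z - 1 by lia.
have -> : k.+1%:Z - 1 = k by lia.
rewrite sigma_rec !rmorphN rmorphB /=.
exact: cf_step.
Qed.

Lemma cf_rec_unique (X : nat -> ZM) :
  (forall k, X k.+2 = (-1 + a_ k.+2) * X k + (1 + b_ k.+2) * X k.+1) ->
  forall k, X k = cf_rec (X 0) (X 1) k.
Proof.
move=> Xrec k; suff [] : X k = cf_rec (X 0) (X 1) k
  /\ X k.+1 = cf_rec (X 0) (X 1) k.+1 by [].
elim: k => [//|k [IH0 IH1]]; split; first exact: IH1.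
rewrite (Xrec k) IH0 IH1; exact: erefl.
Qed.

Lemma P_cf_numer k : P_ k = cf_numer 0 k.
Proof.
have sz j : j < 0 -> signed_sum 0 j = 0 by exact: signed_sum_lt.
have [sg2 sg3] : sigma 2 = 1 /\ sigma 3 = 0 by [].
have S0 : signed_sum 0 0%N = b_ 0.
  rewrite (@signed_sum_rec 0 0 isT) big_seq1 [is_a _]/= subn0 sg2 rmorph1.
  by rewrite !sz // !addr0 mulr1 oppr0 add0r.
have S1 : signed_sum 0 1%N = b_ 1 * b_ 0 + a_ 1.
  rewrite (@signed_sum_rec 0 1 isT) sum_indets_atS.
  rewrite [is_a (IndetA _)]/= [is_a (IndetB _)]/= !subSS !subn0 sg2 sg3.
  rewrite rmorph1 rmorph0 (_ : 1%N%:Z - 1%N%:Z = 0%N) // S0 !sz // !addr0.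
  by rewrite oppr0 !add0r [X in _ + X]mulr1.
have P0 : cf_numer 0 0 = b_ 0 by rewrite /cf_numer sz // S0 !add0r.
have P1 : cf_numer 0 1 = -1 + b_ 0 + b_ 1 * b_ 0 + a_ 1.
  rewrite /cf_numer (_ : 1%N%:Z - 1 = 0%N) // S0 S1.
  by rewrite (_ : - sigma 1 = -1) // rmorphN1 !addrA.
by rewrite (cf_rec_unique (fun k => @cf_numer_rec 0 k isT)) P0 P1.
Qed.

Lemma rmorph_cf_step (R S : pzRingType) (f : {rmorphism R -> S}) (a b u v : R) :
  - f ((-1 + a) * u + (1 + b) * v) = (-1 + f a) * - f u + (1 + f b) * - f v.
Proof.
by rewrite rmorphD !rmorphM !rmorphD rmorphN1 rmorph1 !mulrN opprD.
Qed.

Lemma rmorph_cf_numer (R S : pzRingType) (f : {rmorphism R -> S}) (n : int)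
    (u v : R) :
  - f ((- n)%:~R + u + v) = n%:~R - f u - f v.
Proof. by rewrite !rmorphD rmorph_int !opprD rmorphN opprK. Qed.

Lemma phi_a j : phi (a_ j.+2) = a_ j.+1.
Proof. exact: phi_indet_poly. Qed.

Lemma phi_b j : phi (b_ j.+2) = b_ j.+1.
Proof. exact: phi_indet_poly. Qed.

Lemma phi_cf_step (a b u v : ZM) :
  - phi ((-1 + a) * u + (1 + b) * v)
  = (-1 + phi a) * - phi u + (1 + phi b) * - phi v.
Proof. exact: (rmorph_cf_step phi). Qed.

Lemma phi_cf_numer c k :
  - phi (cf_numer c k)
  = (sigma k)%:~R - phi (signed_sum c (k%:Z - 1)) - phi (signed_sum c k%:Z).
Proof. exact: (rmorph_cf_numer phi). Qed.

Lemma Q_cf_numer k : Q_ k = - phi (cf_numer 2 k.+1).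
Proof.
have sz j : j < 2 -> signed_sum 2 j = 0 by exact: signed_sum_lt.
have N0 : cf_numer 2 0 = 0 by rewrite /cf_numer !sz // !addr0.
have N1 : cf_numer 2 1 = - 1 by rewrite /cf_numer !sz // !addr0.
(* Opening with X 0 = 0 instead of Q_0 makes X 2 = 1 + b_1 an instance of the
   recurrence. *)
pose X j := - phi (cf_numer 2 j); rewrite -[RHS]/(X k.+1).
have X0 : X 0%N = 0 by rewrite /X N0 rmorph0 oppr0.
have X1 : X 1%N = 1 by rewrite /X N1 rmorphN opprK rmorph1.
have Xrec j : X j.+2 = (-1 + phi (a_ j.+2)) * X j + (1 + b_ j.+1) * X j.+1.
  by rewrite -(phi_b j) -phi_cf_step -(@cf_numer_rec 2 j isT).
have X2 : X 2 = 1 + b_ 1.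
  rewrite (Xrec 0) X0 X1; move: (phi _) (b_ 1) => a b.
  by rewrite mulr0 add0r mulr1.
clearbody X.
have X'rec j :
    X j.+3 = (-1 + a_ j.+2) * X j.+1 + (1 + b_ j.+2) * X j.+2.
  by rewrite (Xrec j.+1) phi_a.
by have := @cf_rec_unique (fun j => X j.+1) X'rec k; rewrite X1 X2 => ->.
Qed.

Theorem theorem18 (k : nat) :
  P_ k = (- sigma k)%:~R
         + \sum_(m <- calR (k%:Z - 1)) (-1) ^+ g_ (k%:Z - 1) m * << m >>
         + \sum_(m <- calR k%:Z) (-1) ^+ g_ k%:Z m * << m >>
  /\
  Q_ k = (sigma k.+1)%:~R
         - \sum_(m <- calR k%:Z | (1 < last_mindex m)%N)
             (-1) ^+ g_ k%:Z m * phi << m >>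
         - \sum_(m <- calR (k%:Z + 1) | (1 < last_mindex m)%N)
             (-1) ^+ g_ (k%:Z + 1) m * phi << m >>.
Proof.
split; first exact: P_cf_numer.
have phi_sum j : phi (signed_sum 2 j) =
    \sum_(m <- calR j | (1 < last_mindex m)%N) (-1) ^+ g_ j m * phi << m >>.
  by rewrite rmorph_sum; apply: eq_bigr => m _; rewrite rmorphM rmorph_sign.
have := etrans (Q_cf_numer k) (phi_cf_numer 2 k.+1).
have -> : k.+1%:Z - 1 = k by lia.
have -> : k.+1%:Z = k%:Z + 1 by lia.
by rewrite -(phi_sum k%:Z) -(phi_sum (k%:Z + 1)).
Qed.
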